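(* Let $V_a$, $\{V_{a_i}\}_{i\in\mathbb{N}}$, $\{R_i\}_{i\in\mathbb{N}}$ be a space splitting as in the context: $\mathrm{span}(\{R_iV_{a_i}\}_{i\in\mathbb{N}})$ is dense in $V_a$, and for some constant $\Lambda$ one has $\|R_iv_i\|_a\le \Lambda\|v_i\|_{a_i}$ for all $v_i\in V_{a_i}$, $i\in\mathbb{N}$. Let $u\in V_a$ be the solution of the variational problem $a(u,v)=F(v)$ for all $v\in V$. Let $u^{(m)}$, $m\ge 0$, be the iterates of the Schwarz iterative method described in the context, with $u^{(0)}=0$, $\alpha_m=1-(m+2)^{-1}$, and $\omega_m$ given by exact error minimization. a) (Greedy ordering.) Let $\beta\in(0,1]$ and assume that for every $m\ge 0$ the index $i_m\in\mathbb{N}$ satisfies $$a_{i_m}(r^{(m)}_{i_m},r^{(m)}_{i_m})\ge \beta^2\sup_{i\in\mathbb{N}}a_i(r^{(m)}_i,r^{(m)}_i),\qquad r^{(m)}_i:=T_i(u-u^{(m)}).$$ If $u\in\mathcal{A}_1$, then $$\|u-u^{(m)}\|_a^2\le 2\left(\|u\|_a^2+(\Lambda/\beta)^2\|u\|_{\mathcal{A}_1}^2\right)(m+1)^{-1},\qquad m\ge 0.$$ b) (Random ordering.) Assume that the indices $i_m\in\mathbb{N}$, $m\ge 0$, are chosen randomly and independently according to a fixed discrete probability distribution $\pi=\{\pi_i\}_{i\in\mathbb{N}}$. If $u\in\mathcal{A}^{\pi}_\infty$, then $$E(\|u-u^{(m)}\|_a^2)\le 2\left(\|u\|_a^2+\Lambda^2\|u\|_{\mathcal{A}^{\pi}_\infty}^2\right)(m+1)^{-1},\qquad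 m\ge 0.$$
   Context: **Setting.** $V$ is a separable real or complex Hilbert space, $a(\cdot,\cdot)$ is a continuous coercive Hermitian form on $V$, and $V_a$ denotes $V$ equipped with the (equivalent) scalar product $a$ and norm $\|v\|_a=a(v,v)^{1/2}$. Hermitian forms are linear in the first argument. $F$ is a bounded linear functional on $V$ (conjugate-linear in the complex case), so that the problem ''find $u\in V$ with $a(u,v)=F(v)$ for all $v\in V$'' has a unique solution. For each $i\in\mathbb{N}$, $V_{a_i}$ is a Hilbert space with scalar product $a_i(\cdot,\cdot)$ and norm $\|\cdot\|_{a_i}$, and $R_i:V_{a_i}\to V_a$ is a bounded linear operator. No stability of the splitting is assumed. **Operators $T_i$.** $T_i:V_a\to V_{a_i}$ is defined by $a_i(T_iv,v_i)=a(v,R_iv_i)$ for all $v_i\in V_{a_i}$. **Schwarz iterative method.** Given $u^{(m)}$, an index $i=i_m\in\mathbb{N}$ is picked (by the rule specified in the claim), one computes $r_i^{(m)}=T_i(u-u^{(m)})$ and sets $$u^{(m+1)}=\alpha_mu^{(m)}+\omega_mR_ir_i^{(m)},\qquad \alpha_m=1-(m+2)^{-1},\qquad \omega_m=\frac{a(u-\alpha_mu^{(m)},R_ir_i^{(m)})}{\|R_ir_i^{(m)}\|_a^2},$$ i.e. $\omega_m$ is the minimizer of $\omega\mapsto\|u-\alpha_mu^{(m)}-\omega R_ir_i^{(m)}\|_a$ over scalars $\omega$. If $R_ir_i^{(m)}=0$, the value of $\omega_m$ is irrelevant and $u^{(m+1)}=\alpha_mu^{(m)}$. **Approximation spaces.**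 A discrete probability distribution is a sequence $\pi=\{\pi_i\}_{i\in\mathbb{N}}$ with $\pi_i\ge0$, $\sum_i\pi_i=1$; $\mathrm{supp}(\pi)=\{i:\pi_i>0\}$. For a non-negative weight sequence $\gamma=\{\gamma_i\}_{i\in\mathbb{N}}$ and $0<q\le\infty$, define for $u\in\mathrm{span}(\{R_iV_{a_i}\}_{i\in\mathrm{supp}(\gamma)})$ $$\|u\|_{\mathcal{A}^\gamma_q}=\inf\left\{\big\|\{\gamma_i^{-1}\|v_i\|_{a_i}\}_{i\in I}\big\|_{\ell^q}:\ u=\sum_{i\in I}R_iv_i,\ v_i\in V_{a_i},\ I\subset\mathrm{supp}(\gamma)\text{ finite}\right\},$$ and let $\mathcal{A}^\gamma_q$ be the completion with respect to this (quasi-)norm. $\mathcal{A}_q$ denotes the case $\gamma_i=1$ for all $i$. For $\mathcal{A}_1$ and $\mathcal{A}_\infty^\pi$ one has $\|\cdot\|_a\le\Lambda\|\cdot\|_{\mathcal{A}}$ on finite sums, and elements of these completions are regarded as elements of $V_a$ via the continuous extension of the inclusion of the span into $V_a$. *)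

(* Defs.v *)
From HB Require Import structures.
From mathcomp Require Export all_boot all_order all_algebra finmap.
From mathcomp.real_closed Require Export complex.
From mathcomp Require Export all_classical all_reals all_analysis.

Set Implicit Arguments.
Unset Strict Implicit.
Unset Printing Implicit Defensive.

Import Order.TTheory GRing.Theory Num.Theory.
Import numFieldNormedType.Exports.

Local Open Scope classical_set_scope.
Local Open Scope ring_scope.

Variant scalar_kind := RealScalars | ComplexScalars.

Definition scalar (R : realType) (k : scalar_kind) : numFieldType :=
  match k with RealScalars => R | ComplexScalars => R[i] end.

Definition scalar_conj (R : realType) (k : scalar_kind) :
    {rmorphism scalar R k -> scalar R k} :=
  match k with RealScalars => idfun | ComplexScalars => @conjc R end.

Definition scalar_re (R : realType) (k : scalar_kind) : scalar R k -> R :=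
  match k return scalar R k -> R with
  | RealScalars => fun x => x
  | ComplexScalars => @complex.Re R
  end.

(* The norm of a normed module over R[i] takes its values in R[i]; the axiom
   below is an equation in the scalar field. *)
Record hilbert (R : realType) (k : scalar_kind) := Hilbert {
  hilbert_sort :> completeNormedModType (scalar R k);
  hdot : {dot hilbert_sort for @scalar_conj R k};
  hilbert_normE : forall x : hilbert_sort, `|x| ^+ 2 = hdot x x }.

Arguments hdot {R k} h.

Definition form_norm (R : realType) (k : scalar_kind)
    (W : lmodType (scalar R k)) (b : W -> W -> scalar R k) (w : W) : R :=
  Num.sqrt (scalar_re (b w w)).

Definition supp (R : realType) (gamma : nat -> R) : set nat :=
  [set i | 0 < gamma i].

(* Since each R_i V_i is a linear subspace, the span of their union is the set
   of finite sums with one term per index. *)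
Definition splitting_span (R : realType) (k : scalar_kind) (V : hilbert R k)
    (Vi : nat -> hilbert R k) (Ri : forall i, {linear Vi i -> V})
    (S : set nat) : set V :=
  [set x | exists (I : {fset nat}) (v : forall i, Vi i),
     [set` I] `<=` S /\ x = \sum_(i <- I) Ri i (v i)].

(* Only 0 < q <= +oo is meaningful. *)
Definition lq_norm (R : realType) (q : \bar R) (I : {fset nat})
    (x : nat -> R) : R :=
  match q with
  | r%:E => (\sum_(i <- I) `|x i| `^ r) `^ r^-1
  | +oo%E => \big[Num.max/0]_(i <- I) `|x i|
  | -oo%E => 0
  end.

Definition A_norm (R : realType) (k : scalar_kind) (V : hilbert R k)
    (Vi : nat -> hilbert R k) (Ri : forall i, {linear Vi i -> V})
    (gamma : nat -> R) (q : \bar R) (x : V) : R :=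
  inf [set N | exists (I : {fset nat}) (v : forall i, Vi i),
    [/\ [set` I] `<=` supp gamma,
        x = \sum_(i <- I) Ri i (v i) &
        N = lq_norm q I
              (fun i => (gamma i)^-1 * form_norm (hdot (Vi i)) (v i))]].

(* Elements of the completion are given by Cauchy sequences of the span; the
   norm and the image in V_a defined below take the same value on sequences
   whose difference tends to 0 in the norm A_norm. *)
Record A_space (R : realType) (k : scalar_kind) (V : hilbert R k)
    (Vi : nat -> hilbert R k) (Ri : forall i, {linear Vi i -> V})
    (gamma : nat -> R) (q : \bar R) := ASpace {
  A_seq :> nat -> V;
  A_seq_span : forall n, splitting_span Ri (supp gamma) (A_seq n);
  A_seq_cauchy : forall e : R, 0 < e -> exists N : nat, forall m n : nat,
    (N <= m)%N -> (N <= n)%N -> A_norm Ri gamma q (A_seq m - A_seq n) < e }.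

Definition A_space_norm (R : realType) (k : scalar_kind) (V : hilbert R k)
    (Vi : nat -> hilbert R k) (Ri : forall i, {linear Vi i -> V})
    (gamma : nat -> R) (q : \bar R) (x : A_space Ri gamma q) : R :=
  lim (A_norm Ri gamma q (x n) @[n --> \oo]).

(* u is the image of x under the continuous extension to the completion of the
   inclusion of the span into V_a. *)
Definition A_space_image (R : realType) (k : scalar_kind) (V : hilbert R k)
    (a : V -> V -> scalar R k)
    (Vi : nat -> hilbert R k) (Ri : forall i, {linear Vi i -> V})
    (gamma : nat -> R) (q : \bar R) (x : A_space Ri gamma q) (u : V) : Prop :=
  form_norm a (x n - u) @[n --> \oo] --> (0 : R).

Section schwarz.
Variables (R : realType) (k : scalar_kind) (V : hilbert R k).
Variables (a : V -> V -> scalar R k) (Vi : nat -> hilbert R k).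
Variables (Ri : forall i, {linear Vi i -> V}) (Ti : forall i, V -> Vi i).
Variable u : V.

Definition residual (w : V) (i : nat) : Vi i := Ti i (u - w).

Definition alpha (m : nat) : scalar R k := 1 - (m.+2)%:R^-1.

(* a z z is the square of the norm of z in V_a. When z = 0, division by zero
   yields 0, but then the value is irrelevant in schwarz_step. *)
Definition omega (m : nat) (w z : V) : scalar R k :=
  a (u - alpha m *: w) z / a z z.

Definition schwarz_step (m i : nat) (w : V) : V :=
  let z := Ri i (residual w i) in
  alpha m *: w + omega m w z *: z.

Fixpoint schwarz_iter (idx : nat -> nat) (m : nat) : V :=
  if m is m'.+1 then schwarz_step m' (idx m') (schwarz_iter idx m') else 0.

End schwarz.

Definition prob_distribution (R : realType) (pi : nat -> R) : Prop :=
  (forall i, 0 <= pi i) /\ (\sum_(0 <= i <oo) (pi i)%:E = 1)%E.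

Definition mutually_independent (d d' : measure_display)
    (Omega : measurableType d) (T : measurableType d') (R : realType)
    (P : probability Omega R) (X : nat -> {RV P >-> T}) : Prop :=
  forall (J : {fset nat}) (B : nat -> set T),
    (forall j, measurable (B j)) ->
    P (\bigcap_(j in [set` J]) (X j @^-1` B j)) =
      (\prod_(j <- J) P (X j @^-1` B j))%E.

(* Main.v *)
Require Import Defs.
From mathcomp Require Import ring lra measurable_realfun.

Set Implicit Arguments.
Unset Strict Implicit.
Unset Printing Implicit Defensive.

Import Order.TTheory GRing.Theory Num.Theory.
Import numFieldNormedType.Exports.

Local Open Scope classical_set_scope.
Local Open Scope ring_scope.

(** Write [e = u - u^(m)], [s = 1/(m+2)] and [z = R_i T_i e], so that
    [u - alpha_m u^(m) = (1 - s) e + s u] and [a(e, z) = ||T_i e||^2].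
    Since [omega_m] is optimal, it may be replaced by [s N / ||T_i e||] for any
    [N >= 0]; expanding the square gives
      [||e'||^2 <= (1-s)^2 ||e||^2 + 2 s (1-s) (Re a(e,u) - N ||T_i e||)
                   + 2 s^2 (||u||^2 + Lambda^2 N^2)].
    A decomposition [u = sum_j R_j v_j] yields
    [Re a(e,u) <= sum_j ||T_j e|| ||v_j||], which makes the cross term
    nonpositive with [N = ||u||_{A_1} / beta] for the greedy choice, and
    nonpositive on average over [i] with [N = ||u||_{A_oo^pi}] for the random
    one.  The recursion [x_(m+1) <= (1-s)^2 x_m + s^2 C] then keeps
    [x_m <= C / (m+1)]. *)

(** * Real parts and conjugation, uniformly for real and complex scalars *)

Section scalars.
Variables (R : realType) (k : scalar_kind).
Implicit Types (x y : scalar R k) (s t : R).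

(** Step sizes are taken real and act on vectors through this embedding; conjugation fixes them, and
    they factor out of real parts. *)
Definition scalar_of : R -> scalar R k :=
  match k return R -> scalar R k with
  | RealScalars => fun t => t
  | ComplexScalars => fun t => real_complex R t
  end.

Lemma scalar_reD x y : scalar_re (x + y) = scalar_re x + scalar_re y.
Proof. by case: k x y => //= -[a b] [c d]. Qed.

Lemma scalar_reN x : scalar_re (- x) = - scalar_re x.
Proof. by case: k x => //= -[a b]. Qed.

Lemma scalar_re0 : scalar_re (0 : scalar R k) = 0.
Proof. by case: k. Qed.

Lemma scalar_re_conj x : scalar_re (scalar_conj R k x) = scalar_re x.
Proof. by case: k x => //= -[a b]. Qed.

Lemma scalar_conj_of t : scalar_conj R k (scalar_of t) = scalar_of t.
Proof. by rewrite /scalar_of; case: k => //=; rewrite oppr0. Qed.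

Lemma scalar_re_ofM t x : scalar_re (scalar_of t * x) = t * scalar_re x.
Proof.
rewrite /scalar_of; case: k x => //= -[a b] /=.
by rewrite mul0r subr0.
Qed.

Lemma le_scalar_re x y : x <= y -> scalar_re x <= scalar_re y.
Proof. by case: k x y => //= x y; rewrite lecE => /andP[]. Qed.

Lemma scalar_mul_conj_ge0 x : 0 <= x * scalar_conj R k x.
Proof.
case: k x => /= [x|[a b]]; first by rewrite -expr2 sqr_ge0.
rewrite lecE /= !mulrN opprK [b * a]mulrC addNr eqxx /= -!expr2.
by rewrite addr_ge0 ?sqr_ge0.
Qed.

Lemma alpha_scalar_of m : alpha R k m = scalar_of (1 - m.+2%:R^-1).
Proof.
rewrite /alpha /scalar_of; case: k => //=.
by rewrite rmorphB rmorph1 fmorphV rmorph_nat.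
Qed.

End scalars.

(** * Positive semidefinite Hermitian forms and the optimal step size *)

Section forms.
Variables (R : realType) (k : scalar_kind) (W : lmodType (scalar R k)).
Variable b : {hermitian_sym W for @scalar_conj R k}.
Hypothesis b_ge0 : forall x, 0 <= b x x.
Implicit Types (x y z : W) (s t : R).

(** A symmetric form, bilinear over the reals, so the estimates below treat both kinds of scalars at
    once. *)
Definition re_form x y := scalar_re (b x y).

Lemma re_formDl x y z : re_form (x + y) z = re_form x z + re_form y z.
Proof. by rewrite /re_form linearDl scalar_reD. Qed.

Lemma re_formDr x y z : re_form x (y + z) = re_form x y + re_form x z.
Proof. by rewrite /re_form linearDr scalar_reD. Qed.

Lemma re_form_sumr x (I : Type) (r : seq I) (F : I -> W) :
  re_form x (\sum_(i <- r) F i) = \sum_(i <- r) re_form x (F i).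
Proof.
rewrite /re_form linear_sumr; apply: (big_morph (@scalar_re R k)); last exact: scalar_re0.
exact: scalar_reD.
Qed.

Lemma re_formNl x y : re_form (- x) y = - re_form x y.
Proof. by rewrite /re_form linearNl scalar_reN. Qed.

Lemma re_formNr x y : re_form x (- y) = - re_form x y.
Proof. by rewrite /re_form linearNr scalar_reN. Qed.

Lemma re_formZl t x y : re_form (scalar_of k t *: x) y = t * re_form x y.
Proof. by rewrite /re_form linearZl_LR scalar_re_ofM. Qed.

Lemma re_formZr t x y : re_form x (scalar_of k t *: y) = t * re_form x y.
Proof. by rewrite /re_form linearZr_LR /= scalar_conj_of scalar_re_ofM. Qed.

Lemma re_formC x y : re_form x y = re_form y x.
Proof. by rewrite /re_form hermC /= expr0 mul1r scalar_re_conj. Qed.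

Lemma re_form_ge0 x : 0 <= re_form x x.
Proof. by rewrite -(scalar_re0 R k) le_scalar_re. Qed.

Lemma form_norm_ge0 x : 0 <= form_norm b x.
Proof. exact: sqrtr_ge0. Qed.

Lemma sqr_form_norm x : form_norm b x ^+ 2 = re_form x x.
Proof. by rewrite sqr_sqrtr // re_form_ge0. Qed.

Lemma re_form_comb s t x y (z := scalar_of k s *: x + scalar_of k t *: y) :
  re_form z z =
  s ^+ 2 * re_form x x + 2 * s * t * re_form x y + t ^+ 2 * re_form y y.
Proof.
rewrite /z !(re_formDl, re_formDr, re_formZl, re_formZr) [re_form y x]re_formC.
ring.
Qed.

Lemma re_form_sub x y t (z := x - scalar_of k t *: y) :
  re_form z z = re_form x x - 2 * t * re_form x y + t ^+ 2 * re_form y y.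
Proof.
rewrite /z !(re_formDl, re_formDr, re_formNl, re_formNr, re_formZl, re_formZr).
rewrite [re_form y x]re_formC; ring.
Qed.

Lemma re_form_le x y : re_form x y <= form_norm b x * form_norm b y.
Proof.
have [xy0|xy0] := leP (re_form x y) 0.
  by rewrite (le_trans xy0)// mulr_ge0 ?form_norm_ge0.
rewrite -ler_sqr ?nnegrE ?(ltW xy0) ?mulr_ge0 ?form_norm_ge0//.
rewrite exprMn !sqr_form_norm.
have [yy0|yyN0] := eqVneq (re_form y y) 0.
  (* With [re_form y y = 0] the square is affine in the coefficient of [y], and this coefficient
     would make it equal to -1. *)
  have := re_form_ge0 (x - scalar_of k ((re_form x x + 1) / (2 * re_form x y)) *: y).
  rewrite re_form_sub yy0 mulr0 addr0.
  have -> : 2 * ((re_form x x + 1) / (2 * re_form x y)) * re_form x y = re_form x x + 1.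
    by field; rewrite gt_eqF.
  lra.
have yy_gt0 : 0 < re_form y y by rewrite lt_def yyN0 re_form_ge0.
have := re_form_ge0 (x - scalar_of k (re_form x y / re_form y y) *: y).
rewrite re_form_sub.
have -> : re_form x x - 2 * (re_form x y / re_form y y) * re_form x y +
  (re_form x y / re_form y y) ^+ 2 * re_form y y =
  (re_form x x * re_form y y - re_form x y ^+ 2) / re_form y y by field.
by rewrite pmulr_lge0 ?invr_gt0// subr_ge0.
Qed.

Lemma re_form_abs_le x y : `|re_form x y| <= form_norm b x * form_norm b y.
Proof.
rewrite ler_norml re_form_le andbT lerNl -re_formNl.
rewrite (le_trans (re_form_le _ _))// le_eqVlt; apply/orP; left.
by apply/eqP; congr (_ * _); rewrite /form_norm linearNl linearNr opprK.
Qed.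

Lemma form_normD x y :
  form_norm b (x + y) <= form_norm b x + form_norm b y.
Proof.
rewrite -ler_sqr ?nnegrE ?addr_ge0 ?form_norm_ge0// sqrrD !sqr_form_norm.
rewrite re_formDl !re_formDr [re_form y x]re_formC.
have := re_form_le x y; lra.
Qed.

(** Parallelogram identity with the square of [x + y] dropped. *)
Lemma form_normB_le2 x y :
  form_norm b (x - y) ^+ 2 <= 2 * (form_norm b x ^+ 2 + form_norm b y ^+ 2).
Proof.
rewrite !sqr_form_norm.
have := re_form_ge0 (x + y).
rewrite !re_formDl !re_formDr !re_formNl !re_formNr [re_form y x]re_formC; lra.
Qed.

(** The remainder of the projection is orthogonal to [z] over the full scalar field, so Pythagoras
    applies. Real competitors [t] are enough for the later estimates. *)
Lemma form_norm_minimizer x z t :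
  form_norm b (x - (b x z / b z z) *: z) <= form_norm b (x - scalar_of k t *: z).
Proof.
rewrite ler_sqrt ?re_form_ge0//.
(* In the degenerate case the quotient is 0 by convention, and Cauchy-Schwarz removes the cross term
   on the right. *)
have [zz0|zzN0] := eqVneq (b z z) 0.
  have xz0 : re_form x z = 0.
    apply/normr0_eq0/eqP; rewrite eq_le normr_ge0 andbT.
    rewrite (le_trans (re_form_abs_le _ _))//.
    by rewrite {2}/form_norm zz0 scalar_re0 sqrtr0 mulr0.
  rewrite zz0 invr0 mulr0 scale0r subr0 -!/(re_form _ _) re_form_sub xz0.
  by rewrite mulr0 subr0 lerDl mulr_ge0 ?sqr_ge0 ?re_form_ge0.
apply: le_scalar_re.
set w := b x z / b z z; set p := x - w *: z.
have pz : b p z = 0.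
  by rewrite /p linearBl linearZl_LR /= divfK// subrr.
have zp : b z p = 0 by rewrite hermC pz rmorph0 mulr0.
have -> : x - scalar_of k t *: z = p + (w - scalar_of k t) *: z.
  by rewrite /p scalerBl addrA subrK.
move: p pz zp => p pz zp.
rewrite linearDl !linearDr !linearZl_LR !linearZr_LR /= pz zp.
rewrite !mulr0 addr0 add0r lerDl.
rewrite -[_ *: _]/(_ * _) mulrCA mulrA mulr_ge0//.
exact: scalar_mul_conj_ge0.
Qed.

End forms.

Lemma hdot_ge0 (R : realType) (k : scalar_kind) (W : hilbert R k) (w : W) :
  0 <= hdot W w w.
Proof. by rewrite -hilbert_normE exprn_ge0. Qed.

(** Extension by zero, which lets sums over two index sets be added over their union. *)
Lemma sum_fset_mkcond (M : nmodType) (I J : {fset nat}) (F : nat -> M) :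
  (I `<=` J)%fset ->
  \sum_(i <- I) F i = \sum_(i <- J) if i \in I then F i else 0.
Proof.
move=> IJ; rewrite -big_mkcond -big_filter; apply: perm_big.
apply: uniq_perm => //; first by rewrite filter_uniq.
move=> i; rewrite mem_filter; case: (boolP (i \in I)) => //= iI.
by rewrite (fsubsetP IJ).
Qed.

(** * Finite l^q norms for q = 1 and q = oo *)

Section lq_norm.
Variable R : realType.
Implicit Types (q : \bar R) (I J : {fset nat}) (f g h : nat -> R).

Lemma lq_norm_ge0 q I f : 0 <= lq_norm q I f.
Proof.
case: q => [r| |] //=; first exact: powR_ge0.
by elim/big_ind : _ => // x y x0 y0; rewrite le_max x0.
Qed.

Lemma lq_norm1 I f : lq_norm 1%:E I f = \sum_(i <- I) `|f i|.
Proof.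
rewrite /= invr1 powRr1; last by rewrite sumr_ge0// => i _; exact: powR_ge0.
by apply: eq_bigr => i _; rewrite powRr1.
Qed.

Lemma lq_normy_ge I f i : i \in I -> `|f i| <= lq_norm +oo%E I f.
Proof. by move=> iI; exact: (le_bigmax_seq 0 i xpredT (fun j => `|f j|) iI isT). Qed.

Lemma lq_norm_fsetU q I J f g h : q = 1%:E \/ q = +oo%E ->
  (forall i, `|h i| <= (if i \in I then `|f i| else 0) +
                       (if i \in J then `|g i| else 0)) ->
  lq_norm q (I `|` J)%fset h <= lq_norm q I f + lq_norm q J g.
Proof.
move=> [->|->] hfg.
  rewrite !lq_norm1.
  rewrite (sum_fset_mkcond _ (fsubsetUl I J)) (sum_fset_mkcond _ (fsubsetUr I J)).
  rewrite -big_split; exact: ler_sum.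
rewrite /=; apply/bigmax_le => [|i _].
  by rewrite addr_ge0 ?(lq_norm_ge0 +oo%E).
rewrite (le_trans (hfg i))// lerD//.
  by case: ifPn => [/lq_normy_ge//|_]; exact: (lq_norm_ge0 +oo%E).
by case: ifPn => [/lq_normy_ge//|_]; exact: (lq_norm_ge0 +oo%E).
Qed.

End lq_norm.

(** * Norms on the span and on its completion *)

Section approximation_spaces.
Variables (R : realType) (k : scalar_kind) (V : hilbert R k).
Variables (Vi : nat -> hilbert R k) (Ri : forall i, {linear Vi i -> V}).
Variables (gamma : nat -> R) (q : \bar R).
Hypothesis q1y : q = 1%:E \/ q = +oo%E.
Implicit Types (x y : V).

Let norms (v : forall i, Vi i) :=
  fun i => (gamma i)^-1 * form_norm (hdot (Vi i)) (v i).

Lemma A_norm_le (I : {fset nat}) (v : forall i, Vi i) :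
  [set` I] `<=` supp gamma ->
  A_norm Ri gamma q (\sum_(i <- I) Ri i (v i)) <= lq_norm q I (norms v).
Proof.
move=> Ig; apply: ge_inf; last by exists I, v.
by exists 0 => _ [J [w [_ _ ->]]]; exact: lq_norm_ge0.
Qed.

(** Membership in the span makes the set of decomposition norms nonempty; otherwise [inf] would be a
    default value. *)
Lemma le_A_norm x c : splitting_span Ri (supp gamma) x ->
  (forall (I : {fset nat}) (v : forall i, Vi i), [set` I] `<=` supp gamma ->
    x = \sum_(i <- I) Ri i (v i) -> c <= lq_norm q I (norms v)) ->
  c <= A_norm Ri gamma q x.
Proof.
move=> [I [v [Ig xE]]] cle; apply: lb_le_inf.
  by exists (lq_norm q I (norms v)), I, v.
by move=> _ [J [w [Jg xE' ->]]]; exact: cle.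
Qed.

Lemma A_norm_ge0 x : splitting_span Ri (supp gamma) x ->
  0 <= A_norm Ri gamma q x.
Proof. by move=> sx; apply: le_A_norm => // I v _ _; exact: lq_norm_ge0. Qed.

Lemma splitting_sum_fsetU (I J : {fset nat}) (v w : forall i, Vi i) :
  \sum_(i <- I) Ri i (v i) + \sum_(i <- J) Ri i (w i) =
  \sum_(i <- (I `|` J)%fset)
    Ri i ((if i \in I then v i else 0) + (if i \in J then w i else 0)).
Proof.
rewrite (sum_fset_mkcond _ (fsubsetUl I J)) (sum_fset_mkcond _ (fsubsetUr I J)).
rewrite -big_split; apply: eq_bigr => i _; rewrite raddfD.
by congr (_ + _); case: ifP => // _; rewrite raddf0.
Qed.

Lemma A_normD x y :
  splitting_span Ri (supp gamma) x -> splitting_span Ri (supp gamma) y ->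
  A_norm Ri gamma q (x + y) <= A_norm Ri gamma q x + A_norm Ri gamma q y.
Proof.
(* Isolating one norm at a time compares each infimum with arbitrary decompositions, so no
   near-minimizers are needed. The two decompositions are then added over the union of their index
   sets. *)
move=> sx sy; rewrite -lerBlDr; apply: le_A_norm => // I v Ig xE.
rewrite lerBlDr -lerBlDl; apply: le_A_norm => // J w Jg yE.
rewrite lerBlDl xE yE splitting_sum_fsetU.
set vw := fun i => (if i \in I then v i else 0) + (if i \in J then w i else 0).
apply: (le_trans (@A_norm_le _ vw _)).
  by move=> i /=; rewrite in_fsetU => /orP[/Ig|/Jg].
apply: lq_norm_fsetU => // i.
rewrite /norms /vw !normrM !(ger0_norm (form_norm_ge0 _ _)).
have n0 : form_norm (hdot (Vi i)) 0 = 0.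
  by rewrite /form_norm linear0l scalar_re0 sqrtr0.
case: ifP => _; case: ifP => _; rewrite ?addr0 ?add0r ?n0 ?mulr0//.
by rewrite -mulrDr ler_wpM2l//; apply: form_normD; exact: hdot_ge0.
Qed.

Lemma splitting_spanB S x y : splitting_span Ri S x ->
  splitting_span Ri S y -> splitting_span Ri S (x - y).
Proof.
move=> [I [v [IS ->]]] [J [w [JS ->]]].
pose vw := fun i => (if i \in I then v i else 0) + (if i \in J then - w i else 0).
exists (I `|` J)%fset, vw; split.
  by move=> i /=; rewrite in_fsetU => /orP[/IS|/JS].
rewrite -splitting_sum_fsetU; congr (_ + _); rewrite -sumrN.
by apply: eq_bigr => i _; rewrite raddfN.
Qed.

(** By the reverse triangle inequality the norms of a Cauchy sequence are Cauchy, so the [lim] in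
    [A_space_norm] is a true limit. *)
Lemma is_cvg_A_norm (x : A_space Ri gamma q) :
  cvg (A_norm Ri gamma q (x n) @[n --> \oo]).
Proof.
apply/cauchy_cvgP/cauchy_ballP => e e0; near_simpl.
have [N cauchyN] := A_seq_cauchy x e0.
have le_dist m n : A_norm Ri gamma q (x m) - A_norm Ri gamma q (x n) <=
    A_norm Ri gamma q (x m - x n).
  rewrite lerBlDr -{1}[x m](subrK (x n)) A_normD//; last exact: A_seq_span.
  by apply: splitting_spanB; exact: A_seq_span.
near=> m n.
have mN : (N <= m)%N by near: m; exact: nbhs_infty_ge.
have nN : (N <= n)%N by near: n; exact: nbhs_infty_ge.
by rewrite /ball /= ltr_norml ltrNl opprB !(le_lt_trans (le_dist _ _))// cauchyN.
Unshelve. all: end_near. Qed.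

Lemma A_space_norm_ge0 (x : A_space Ri gamma q) : 0 <= A_space_norm x.
Proof.
apply: limr_ge; first exact: is_cvg_A_norm.
by near=> n; apply: A_norm_ge0; exact: A_seq_span.
Unshelve. all: end_near. Qed.

(** A bound on all finite decompositions passes to the infimum, and then to the completion because
    [re_form a e] is continuous for the norm of [a]. Both claims use it to estimate
    [re_form a e u]. *)
Lemma le_A_space_norm (a : {hermitian_sym V for @scalar_conj R k}) (e u : V) (S : R)
    (x : A_space Ri gamma q) :
  (forall y, 0 <= a y y) ->
  0 <= S ->
  (forall (I : {fset nat}) (v : forall i, Vi i), [set` I] `<=` supp gamma ->
     re_form a e (\sum_(i <- I) Ri i (v i)) <= S * lq_norm q I (norms v)) ->
  A_space_image a x u ->
  re_form a e u <= S * A_space_norm x.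
Proof.
move=> a0 S0 le_S xu.
have le_SA n : re_form a e (x n) <= S * A_norm Ri gamma q (x n).
  have := A_seq_span x n; move: (x n) => y sy.
  (* Passing to the infimum divides by [S], so [S = 0] is treated through a single decomposition. *)
  have [S_eq0|SN0] := eqVneq S 0.
    have [I [v [Ig ->]]] := sy.
    by rewrite S_eq0 mul0r -(mul0r (lq_norm q I (norms v))) -{1}S_eq0 le_S.
  have S_gt0 : 0 < S by rewrite lt_def SN0.
  rewrite -ler_pdivrMl//; apply: le_A_norm => // I v Ig yE.
  by rewrite ler_pdivrMl// yE le_S.
(* The second summand is the Cauchy-Schwarz cost of replacing [u] by [x n]. *)
have SAcvg : S * A_norm Ri gamma q (x n) + form_norm a e * form_norm a (x n - u)
    @[n --> \oo] --> S * A_space_norm x.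
  rewrite -[X in _ --> X]addr0 -[X in _ --> _ + X](mulr0 (form_norm a e)).
  by apply: cvgD; apply: cvgMr => //; exact: is_cvg_A_norm.
rewrite -(cvg_lim _ SAcvg)//; apply: limr_ge; first by apply/cvg_ex; eexists; exact: SAcvg.
near=> n.
have -> : re_form a e u = re_form a e (x n) - re_form a e (x n - u).
  by rewrite re_formDr re_formNr opprD addrA subrr add0r opprK.
rewrite lerD//.
by rewrite (le_trans (ler_norm _))// normrN re_form_abs_le.
Unshelve. all: end_near. Qed.

End approximation_spaces.

(** For s = 1/(m+2) the value C/(m+1) is carried exactly to C/(m+2), since (m+1)/(m+2)^2 + 1/(m+2)^2
    = 1/(m+2). *)
Lemma le_harmonic_succ (R : realType) (m : nat) (x y C : R) : x <= C / m.+1%:R ->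
  y <= (1 - m.+2%:R^-1) ^+ 2 * x + m.+2%:R^-1 ^+ 2 * C -> y <= C / m.+2%:R.
Proof.
move=> xC /le_trans; apply.
have -> : C / m.+2%:R = (1 - m.+2%:R^-1) ^+ 2 * (C / m.+1%:R) + m.+2%:R^-1 ^+ 2 * C.
  rewrite -[m.+2%:R]natr1; field.
  by rewrite nat1r natr1 !pnatr_eq0.
by rewrite lerD2r ler_wpM2l// sqr_ge0.
Qed.

(** * Error after one step, and the greedy ordering *)

Section schwarz_convergence.
Variables (R : realType) (k : scalar_kind) (V : hilbert R k).
Variable a : {hermitian_sym V for @scalar_conj R k}.
Hypothesis a_ge0 : forall v, 0 <= a v v.
Variables (Vi : nat -> hilbert R k) (Ri : forall i, {linear Vi i -> V}).
Variable Lambda : R.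
Hypothesis Ri_bounded : forall (i : nat) (w : Vi i),
  form_norm a (Ri i w) <= Lambda * form_norm (hdot (Vi i)) w.
Variable Ti : forall i, V -> Vi i.
Hypothesis Ti_def : forall (i : nat) (v : V) (w : Vi i),
  hdot (Vi i) (Ti i v) w = a v (Ri i w).
Variable u : V.
Implicit Types (e v w : V).

Local Notation rho e i := (form_norm (hdot (Vi i)) (Ti i e)).

Lemma re_form_Ri e i (w : Vi i) :
  re_form a e (Ri i w) <= rho e i * form_norm (hdot (Vi i)) w.
Proof.
rewrite /re_form -Ti_def; apply: (@re_form_le _ _ _ (hdot (Vi i))).
exact: hdot_ge0.
Qed.

Lemma re_form_Ri_residual e i : re_form a e (Ri i (Ti i e)) = rho e i ^+ 2.
Proof.
by rewrite (@sqr_form_norm _ _ _ (hdot (Vi i)) (@hdot_ge0 _ _ (Vi i))) /re_form -Ti_def.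
Qed.

Lemma sqr_form_norm_Ri i (w : Vi i) :
  form_norm a (Ri i w) ^+ 2 <= Lambda ^+ 2 * form_norm (hdot (Vi i)) w ^+ 2.
Proof.
rewrite -exprMn ler_sqr ?nnegrE ?form_norm_ge0//.
by rewrite (le_trans (form_norm_ge0 _ _) (Ri_bounded w)).
Qed.

(** Testing the definition of [Ti] with [Ti i e] itself gives a bound uniform in [i], which later
    makes the mean residual finite. The absolute value is there because no sign of [Lambda] is
    assumed. *)
Lemma residual_le e i : rho e i <= `|Lambda| * form_norm a e.
Proof.
have [->|rhoN0] := eqVneq (rho e i) 0.
  by rewrite mulr_ge0// form_norm_ge0.
have rho_gt0 : 0 < rho e i by rewrite lt_def rhoN0 form_norm_ge0.
rewrite -(ler_pM2l rho_gt0) -expr2 -re_form_Ri_residual.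
rewrite (le_trans (re_form_le a_ge0 _ _))//.
rewrite [leRHS]mulrA [leRHS]mulrC ler_wpM2l ?form_norm_ge0//.
by rewrite mulrC (le_trans (Ri_bounded _))// ler_wpM2r ?ler_norm// form_norm_ge0.
Qed.

(** No decomposition of [u] enters here: [N] stays free, so that each ordering can choose it to
    control the cross term. *)
Lemma schwarz_step_le m i w (N : R) (e := u - w) (s : R := m.+2%:R^-1) :
  0 <= N ->
  form_norm a (u - schwarz_step a Ri Ti u m i w) ^+ 2 <=
    (1 - s) ^+ 2 * form_norm a e ^+ 2
    + 2 * (1 - s) * s * (re_form a e u - N * rho e i)
    + s ^+ 2 * (2 * (form_norm a u ^+ 2 + Lambda ^+ 2 * N ^+ 2)).
Proof.
move=> N0; rewrite /schwarz_step /omega /residual -/e.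
set z := Ri i (Ti i e); set x := u - alpha R k m *: w.
have -> : u - (alpha R k m *: w + a x z / a z z *: z) = x - (a x z / a z z) *: z.
  by rewrite opprD addrA.
(* For [rho e i = 0] the division gives [c = 0], which still works. *)
pose c := N / rho e i.
have xE : x = scalar_of k (1 - s) *: e + scalar_of k s *: u.
  have sE : scalar_of k s = 1 - alpha R k m.
    rewrite /alpha opprB addrC subrK /s /scalar_of; case: (k) => //=.
    by rewrite fmorphV rmorph_nat.
  rewrite sE -alpha_scalar_of /x /e; move: (alpha R k m) => al.
  by rewrite scalerBr scalerBl scale1r [RHS]addrC addrA subrK.
have s_ge0 : 0 <= s by rewrite invr_ge0.
apply: (@le_trans _ _ (form_norm a (x - scalar_of k (s * c) *: z) ^+ 2)).
  rewrite ler_sqr ?nnegrE ?form_norm_ge0//; exact: form_norm_minimizer.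
have cE : scalar_of k (s * c) = scalar_of k s * scalar_of k c.
  by rewrite /scalar_of; case: (k) => //=; rewrite rmorphM.
(* The whole correction is attached to the [u] part, so the square expands with weights 1 - s and
   s. *)
have -> : x - scalar_of k (s * c) *: z =
    scalar_of k (1 - s) *: e + scalar_of k s *: (u - scalar_of k c *: z).
  by rewrite xE cE -scalerA [X in _ = _ + X]scalerBr addrA.
set y := u - scalar_of k c *: z.
(* The factor 2 of the final bound arises here; [c] is scaled so that [c * rho e i] is at most
   [N]. *)
have yle : form_norm a y ^+ 2 <= 2 * (form_norm a u ^+ 2 + Lambda ^+ 2 * N ^+ 2).
  apply: (le_trans (form_normB_le2 a_ge0 _ _)).
  rewrite ler_pM2l// lerD2l [leLHS]sqr_form_norm// re_formZl re_formZr mulrA -expr2.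
  rewrite -sqr_form_norm//.
  apply: (@le_trans _ _ (c ^+ 2 * (Lambda ^+ 2 * rho e i ^+ 2))).
    by rewrite ler_wpM2l ?sqr_ge0// sqr_form_norm_Ri.
  rewrite mulrCA ler_wpM2l ?sqr_ge0// /c -exprMn.
  have [->|rhoN0] := eqVneq (rho e i) 0; last by rewrite divfK.
  by rewrite mulr0 expr0n sqr_ge0.
have eyE : re_form a e y = re_form a e u - N * rho e i.
  rewrite /y re_formDr re_formNr re_formZr re_form_Ri_residual /c expr2.
  have [->|rhoN0] := eqVneq (rho e i) 0; first by rewrite !mulr0.
  by rewrite mulrA divfK.
rewrite -eyE [leLHS]sqr_form_norm// re_form_comb -!sqr_form_norm//.
have : s ^+ 2 * form_norm a y ^+ 2 <=
  s ^+ 2 * (2 * (form_norm a u ^+ 2 + Lambda ^+ 2 * N ^+ 2)).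
  by rewrite ler_wpM2l// sqr_ge0.
lra.
Qed.

Lemma greedy_schwarz_bound (beta : R) (idx : nat -> nat) :
  0 < beta <= 1 ->
  (forall m : nat,
     let r := residual Ti u (schwarz_iter a Ri Ti u idx m) in
     ((beta ^+ 2)%:E *
        ereal_sup (range (fun i : nat =>
          (scalar_re (hdot (Vi i) (r i) (r i)))%:E))
      <= (scalar_re (hdot (Vi (idx m)) (r (idx m)) (r (idx m))))%:E)%E) ->
  forall x : A_space Ri (fun=> 1) 1%:E, A_space_image a x u ->
  forall m : nat,
    form_norm a (u - schwarz_iter a Ri Ti u idx m) ^+ 2 <=
    2 * (form_norm a u ^+ 2 + (Lambda / beta) ^+ 2 * A_space_norm x ^+ 2)
      / (m.+1)%:R.
Proof.
move=> /andP[beta_gt0 _] greedy x xu.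
have A0 : 0 <= A_space_norm x by apply: A_space_norm_ge0; left.
elim=> [|m IHm].
  rewrite /= subr0 invr1 mulr1.
  have : 0 <= (Lambda / beta) ^+ 2 * A_space_norm x ^+ 2 by rewrite mulr_ge0 ?sqr_ge0.
  have := sqr_ge0 (form_norm a u); lra.
apply: (le_harmonic_succ IHm); rewrite /=.
set w := schwarz_iter a Ri Ti u idx m.
have N0 : 0 <= A_space_norm x / beta by rewrite divr_ge0// ltW.
have rhoE i : scalar_re (hdot (Vi i) (residual Ti u w i) (residual Ti u w i)) =
    rho (u - w) i ^+ 2.
  by rewrite (@sqr_form_norm _ _ _ (hdot (Vi i)) (@hdot_ge0 _ _ (Vi i))).
(* The greedy rule after taking square roots: the chosen residual dominates every other one up to
   [beta]. *)
have rho_le i : rho (u - w) i <= rho (u - w) (idx m) / beta.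
  rewrite ler_pdivlMr// mulrC -ler_sqr ?nnegrE ?mulr_ge0 ?form_norm_ge0 ?(ltW beta_gt0)//.
  rewrite exprMn -lee_fin -(rhoE (idx m)); apply: le_trans (greedy m).
  rewrite EFinM lee_pmul2l ?lte_fin ?exprn_gt0//.
  by apply: ereal_sup_ubound; exists i => //; rewrite rhoE.
(* Bounding all residuals by the chosen one leaves the l^1 norm of the decomposition. *)
have eu : re_form a (u - w) u <= A_space_norm x / beta * rho (u - w) (idx m).
  rewrite mulrAC -mulrA mulrC.
  apply: (le_A_space_norm (q := 1%:E) _ a_ge0 _ _ xu); [by left| |].
    by rewrite divr_ge0 ?form_norm_ge0// ltW.
  move=> I v _; rewrite lq_norm1 re_form_sumr mulr_sumr ler_sum// => i _.
  rewrite (le_trans (re_form_Ri _ _))// invr1 mul1r ger0_norm ?form_norm_ge0//.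
  by rewrite ler_wpM2r ?form_norm_ge0.
apply: (le_trans (schwarz_step_le m (idx m) w N0)); rewrite -/w.
have -> : (Lambda / beta) ^+ 2 * A_space_norm x ^+ 2 =
    Lambda ^+ 2 * (A_space_norm x / beta) ^+ 2.
  by field; rewrite gt_eqF.
rewrite lerD2r gerDl mulr_ge0_le0 ?subr_le0//.
by rewrite !mulr_ge0 ?invr_ge0 ?subr_ge0 ?invf_le1 ?ler1n.
Qed.
End schwarz_convergence.

(** * Integrals of functions of random variables with values in [nat] *)

Section nat_valued.
Context (d : measure_display) (Omega : measurableType d) (R : realType).
Variable P : probability Omega R.
Implicit Types X Y : Omega -> nat.

Definition measurable_fibers Y := forall n, measurable (Y @^-1` [set n]).

(** Every preimage is a countable union of intersections of fibers, so [g] may be arbitrary. *)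
Lemma measurable_fun_fibers2 X Y (D : set Omega) (g : nat -> nat -> \bar R) :
  measurable_fibers X -> measurable_fibers Y ->
  measurable_fun D (fun w => g (Y w) (X w)).
Proof.
move=> mX mY mD B mB; apply: measurableI => //.
have -> : (fun w => g (Y w) (X w)) @^-1` B =
    \bigcup_n \bigcup_(i in [set i | B (g n i)])
      ((Y @^-1` [set n]) `&` (X @^-1` [set i])).
  apply/seteqP; split=> w /=; first by exists (Y w) => //; exists (X w).
  by move=> [n _ [i Bni [/= -> ->]]].
apply: bigcupT_measurable => n; apply: bigcup_measurable => i _.
exact: measurableI.
Qed.

Lemma ge0_integral_fibers Y (D : set Omega) (f : Omega -> \bar R) :
  measurable_fibers Y -> measurable D -> measurable_fun D f ->
  (forall w, 0 <= f w)%E ->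
  (\int[P]_(w in D) f w =
   \sum_(0 <= n <oo) \int[P]_(w in D `&` Y @^-1` [set n]) f w)%E.
Proof.
move=> mY mD mf f0.
have DE : D = \bigcup_n (D `&` Y @^-1` [set n]).
  by apply/seteqP; split=> [w Dw|w [n _ []]//]; exists (Y w).
rewrite {1}DE ge0_integral_bigcup// -?DE//.
  by move=> n; exact: measurableI.
apply/trivIsetP => i j _ _ /eqP ij; rewrite -subset0 => w.
by move=> [[_ /= wi] [_ /= wj]]; apply: ij; rewrite -wi -wj.
Qed.

Lemma integral_fibers_cst X (D : set Omega) (f : nat -> R) :
  measurable_fibers X -> measurable D -> (forall n, 0 <= f n) ->
  (\int[P]_(w in D) (f (X w))%:E =
   \sum_(0 <= n <oo) (f n)%:E * P (D `&` X @^-1` [set n]))%E.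
Proof.
move=> mX mD f0; rewrite (ge0_integral_fibers mX)//.
- apply: eq_eseriesr => n _.
  rewrite (eq_integral (cst (f n)%:E)) ?integral_cst//; first exact: measurableI.
  by move=> w; rewrite inE => -[_ /= ->].
- exact: (@measurable_fun_fibers2 X X D (fun n _ => (f n)%:E)).
- by move=> w; rewrite lee_fin.
Qed.

(** This replaces conditioning on [Y]: on each fiber of [Y] the variable [X] still has law [pi], so
    the integral there is the probability of the fiber times a [pi]-mean. *)
Lemma integral_indep_le X Y (pi : nat -> R) (g : nat -> nat -> R) (h : nat -> R) :
  measurable_fibers X -> measurable_fibers Y ->
  (forall n i, P (Y @^-1` [set n] `&` X @^-1` [set i]) =
     P (Y @^-1` [set n]) * (pi i)%:E)%E ->
  (forall i, 0 <= pi i) ->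
  (forall n i, 0 <= g n i) -> (forall n, 0 <= h n) ->
  (forall n, (\sum_(0 <= i <oo) (pi i * g n i)%:E <= (h n)%:E)%E) ->
  (\int[P]_w (g (Y w) (X w))%:E <= \int[P]_w (h (Y w))%:E)%E.
Proof.
move=> mX mY YX pi0 g0 h0 gh.
rewrite (ge0_integral_fibers mY)//; last first.
- by move=> w; rewrite lee_fin.
- exact: (@measurable_fun_fibers2 X Y setT (fun n i => (g n i)%:E)).
rewrite (integral_fibers_cst mY)//; apply: lee_nneseries => [n _ _|n _].
  by apply: integral_ge0 => w _; rewrite lee_fin.
rewrite setTI (eq_integral (fun w => (g n (X w))%:E)); last first.
  by move=> w; rewrite inE => /= ->.
rewrite integral_fibers_cst//.
have [p p0 PE] : exists2 p : R, 0 <= p & P (Y @^-1` [set n]) = p%:E.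
  exists (fine (P (Y @^-1` [set n]))); first by rewrite fine_ge0.
  by rewrite fineK// fin_num_measure.
under eq_eseriesr do rewrite YX muleCA -EFinM mulrC PE.
rewrite nneseriesZl; last by move=> i _; rewrite lee_fin mulr_ge0.
by rewrite PE muleC lee_wpmul2r.
Qed.

Lemma mutually_independent_fsetU1 (d' : measure_display)
    (T : measurableType d') (X : nat -> {RV P >-> T}) (J : {fset nat})
    (B : nat -> set T) (j : nat) (C : set T) :
  mutually_independent X -> (forall i, measurable (B i)) -> measurable C ->
  j \notin J ->
  P (\bigcap_(i in [set` J]) (X i @^-1` B i) `&` X j @^-1` C) =
  (P (\bigcap_(i in [set` J]) (X i @^-1` B i)) * P (X j @^-1` C))%E.
Proof.
(* Independence speaks of one family of events, so [C] takes slot [j], which [J] leaves free. *)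
move=> indepX mB mC jJ; pose B' i := if i == j then C else B i.
have B'J i : i \in J -> B' i = B i.
  by rewrite /B'; case: eqP => // ->; rewrite (negbTE jJ).
have capE : \bigcap_(i in [set` J]) (X i @^-1` B i) =
    \bigcap_(i in [set` J]) (X i @^-1` B' i).
  by apply: eq_bigcapr => i /B'J ->.
have mB' i : measurable (B' i) by rewrite /B'; case: ifP.
have := indepX (j |` J)%fset B' mB'.
rewrite big_fsetU1//= -indepX// -capE muleC /B' eqxx => <-.
congr (P _); apply/seteqP; split=> w /=.
  move=> [wJ wj] i; rewrite /= in_fset1U => /predU1P[->|iJ].
    by rewrite eqxx.
  by rewrite -/(B' i) B'J//; exact: wJ.
move=> wJ; split=> [i /= iJ|].
  by rewrite -B'J//; apply: wJ; rewrite /= in_fset1U iJ orbT.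
by have := wJ j; rewrite /= in_fset1U !eqxx; exact.
Qed.

End nat_valued.

(** * The past indices as one discrete random variable *)

Section history.
Context (d : measure_display) (Omega : measurableType d) (R : realType).
Variables (P : probability Omega R) (X : nat -> {RV P >-> nat}).

(* The first [m] indices are coded by a single natural number, so that
   integrals of functions of them split into series over [nat]. *)
Definition history m w : nat := choice.pickle (mkseq (fun j => X j w) m).

(** Invalid codes and positions past the end give 0; iterate [m] reads only the first [m]
    positions. *)
Definition decode (n : nat) : nat -> nat :=
  nth 0%N (odflt [::] (choice.unpickle n)).

Lemma decode_history m w j : (j < m)%N -> decode (history m w) j = X j w.
Proof. by move=> jm; rewrite /decode /history choice.pickleK /= nth_mkseq. Qed.

(** A nonempty fiber is a cylinder, the form to which independence applies. The empty case must be
    kept: a value not attained may still decode to a nonempty cylinder. *)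
Lemma history_fiber m n : history m @^-1` [set n] = set0 \/
  history m @^-1` [set n] =
    \bigcap_(j in [set` [fset i in iota 0 m]%fset]) (X j @^-1` [set decode n j]).
Proof.
have [[w wn]|nw] := pselect (exists w, history m w = n); [right|left]; last first.
  by rewrite -subset0 => w wn; apply: nw; exists w.
apply/seteqP; split=> [v /= vn j|v vn].
  by rewrite /= !inE mem_iota add0n => /andP[_ jm]; rewrite -vn decode_history.
rewrite /= -wn; congr choice.pickle; apply: (@eq_from_nth _ 0%N); rewrite !size_mkseq// => j jm.
rewrite !nth_mkseq// -(@decode_history m w)// wn.
by apply: vn; rewrite /= !inE mem_iota.
Qed.

Lemma measurable_history m : measurable_fibers (history m).
Proof.
move=> n; have [->|->] := history_fiber m n; first exact: measurable0.
apply: fin_bigcap_measurable => [|j _]; first exact: finite_fset.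
by rewrite -[X in measurable X]setTI; exact: measurable_funPT.
Qed.

Lemma history_indep m n i : mutually_independent X ->
  P (history m @^-1` [set n] `&` X m @^-1` [set i]) =
  (P (history m @^-1` [set n]) * P (X m @^-1` [set i]))%E.
Proof.
move=> indepX; have [->|->] := history_fiber m n.
  by rewrite set0I measure0 mul0e.
rewrite (@mutually_independent_fsetU1 _ _ _ _ _ _ _ _
  (fun j => [set decode n j]))//.
by rewrite !inE mem_iota add0n ltnn.
Qed.

End history.

Lemma sum_fset_le_nneseries (R : realType) (I : {fset nat}) (f : nat -> R) :
  (forall i, 0 <= f i) ->
  ((\sum_(i <- I) f i)%:E <= \sum_(0 <= i <oo) (f i)%:E)%E.
Proof.
move=> f0; rewrite -sumEFin nneseries_esumT => [|i]; last by rewrite lee_fin.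
apply: ereal_sup_ubound; exists [set` I]; first by split; [exact: finite_fset|].
by rewrite fsbig_finite/= ?set_fsetK//; exact: finite_fset.
Qed.

(** * The random ordering *)

Section random_schwarz.
Variables (R : realType) (k : scalar_kind) (V : hilbert R k).
Variable a : {hermitian_sym V for @scalar_conj R k}.
Hypothesis a_ge0 : forall v, 0 <= a v v.
Variables (Vi : nat -> hilbert R k) (Ri : forall i, {linear Vi i -> V}).
Variable Lambda : R.
Hypothesis Ri_bounded : forall (i : nat) (w : Vi i),
  form_norm a (Ri i w) <= Lambda * form_norm (hdot (Vi i)) w.
Variable Ti : forall i, V -> Vi i.
Hypothesis Ti_def : forall (i : nat) (v : V) (w : Vi i),
  hdot (Vi i) (Ti i v) w = a v (Ri i w).
Variable u : V.
Variable pi : nat -> R.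
Hypothesis pi_prob : prob_distribution pi.
Variable x : A_space Ri pi +oo%E.
Hypothesis xu : A_space_image a x u.

Local Notation rho e i := (form_norm (hdot (Vi i)) (Ti i e)).

Let pi_ge0 i : 0 <= pi i. Proof. exact: pi_prob.1. Qed.

(** If M is the weighted l^oo norm of a decomposition, then its i-th component has norm at most
    [pi i] times M. The weights thus turn the sum of residuals into their mean [S]. *)
Lemma mean_residual e : exists S : R,
  (\sum_(0 <= i <oo) (pi i * rho e i)%:E)%E = S%:E /\
  re_form a e u <= S * A_space_norm x.
Proof.
have rho_ge0 i : 0 <= pi i * rho e i by rewrite mulr_ge0// form_norm_ge0.
have S_fin : (\sum_(0 <= i <oo) (pi i * rho e i)%:E)%E \is a fin_num.
  rewrite ge0_fin_numE; last by apply: nneseries_ge0 => i _ _; rewrite lee_fin.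
  apply: (@le_lt_trans _ _ (\sum_(0 <= i <oo)
      (`|Lambda| * form_norm a e)%:E * (pi i)%:E)%E).
    apply: lee_nneseries => [i _ _|i _]; first by rewrite lee_fin.
    rewrite -EFinM lee_fin mulrC ler_wpM2r//.
    exact: (residual_le a_ge0 Ri_bounded Ti_def).
  rewrite nneseriesZl => [|i _]; last by rewrite lee_fin.
  by rewrite pi_prob.2 mule1 ltry.
exists (fine (\sum_(0 <= i <oo) (pi i * rho e i)%:E)%E); split; first by rewrite fineK.
apply: (le_A_space_norm (q := +oo%E) _ a_ge0 _ _ xu); [by right| |].
  by rewrite fine_ge0// nneseries_ge0// => i _ _; rewrite lee_fin.
move=> I v Ipi; rewrite re_form_sumr.
set M := lq_norm _ _ _.
apply: (@le_trans _ _ (\sum_(i <- I) pi i * rho e i * M)).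
  rewrite big_seq [leRHS]big_seq ler_sum// => i iI.
  rewrite (le_trans (re_form_Ri Ti_def _ _))// [pi i * _]mulrC -mulrA.
  rewrite ler_wpM2l ?form_norm_ge0//.
  have pi_gt0 : 0 < pi i by exact: Ipi.
  have := lq_normy_ge (fun i => (pi i)^-1 * form_norm (hdot (Vi i)) (v i)) iI.
  rewrite ger0_norm ?mulr_ge0 ?invr_ge0 ?form_norm_ge0//.
  by rewrite ler_pdivrMl.
rewrite -mulr_suml ler_wpM2r ?lq_norm_ge0//.
by rewrite -lee_fin fineK// sum_fset_le_nneseries.
Qed.

Lemma mean_schwarz_step_le m w (s : R := m.+2%:R^-1) :
  (\sum_(0 <= i <oo)
     (pi i * form_norm a (u - schwarz_step a Ri Ti u m i w) ^+ 2)%:E <=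
   ((1 - s) ^+ 2 * form_norm a (u - w) ^+ 2 +
    s ^+ 2 * (2 * (form_norm a u ^+ 2 + Lambda ^+ 2 * A_space_norm x ^+ 2)))%:E)%E.
Proof.
have A0 : 0 <= A_space_norm x by apply: A_space_norm_ge0; right.
have [S [SE eu]] := mean_residual (u - w).
set C := 2 * _; set E := fun i => form_norm a (u - schwarz_step a Ri Ti u m i w) ^+ 2.
have s_ge0 : 0 <= s by rewrite invr_ge0.
have s_le1 : 0 <= 1 - s by rewrite subr_ge0 invf_le1 ?ler1n.
(* The negative part of the cross term is moved to the left, so that the series to be added have
   nonnegative terms; it is subtracted again once its sum [D * S] is known to be finite. *)
pose D := 2 * (1 - s) * s * A_space_norm x.
pose K := (1 - s) ^+ 2 * form_norm a (u - w) ^+ 2 +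
  2 * (1 - s) * s * re_form a (u - w) u + s ^+ 2 * C.
have D0 : 0 <= D by rewrite !mulr_ge0.
have EK i : E i + D * rho (u - w) i <= K.
  have := schwarz_step_le a_ge0 Ri_bounded Ti_def u m i w A0.
  rewrite -/s -/C -/(E i) /K /D; lra.
have sum_le : (\sum_(0 <= i <oo) (pi i * E i)%:E + (D * S)%:E <= K%:E)%E.
  rewrite EFinM -SE -nneseriesZl; last first.
    by move=> i _; rewrite lee_fin mulr_ge0// form_norm_ge0.
  rewrite -nneseriesD; last 2 first.
  - by move=> i _ _; rewrite lee_fin mulr_ge0// sqr_ge0.
  - by move=> i _ _; rewrite -EFinM lee_fin !mulr_ge0// form_norm_ge0.
  apply: (@le_trans _ _ (\sum_(0 <= i <oo) K%:E * (pi i)%:E)%E).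
    apply: lee_nneseries => [i _ _|i _].
      rewrite -EFinM -EFinD lee_fin addr_ge0//.
        by rewrite mulr_ge0// sqr_ge0.
      by rewrite !mulr_ge0// form_norm_ge0.
    rewrite -!EFinM -EFinD lee_fin [D * _]mulrCA -mulrDr mulrC.
    by rewrite ler_wpM2r.
  rewrite nneseriesZl => [|i _]; last by rewrite lee_fin.
  by rewrite pi_prob.2 mule1.
rewrite -leeBrDr// in sum_le; apply: (le_trans sum_le).
rewrite -EFinB lee_fin /K /D.
have : 2 * (1 - s) * s * re_form a (u - w) u <=
    2 * (1 - s) * s * (S * A_space_norm x).
  by rewrite ler_wpM2l// !mulr_ge0.
lra.
Qed.

(** Makes the random iterate a function of [history], hence of a single natural number. *)
Lemma eq_schwarz_iter (idx idx' : nat -> nat) m :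
  (forall j, (j < m)%N -> idx j = idx' j) ->
  schwarz_iter a Ri Ti u idx m = schwarz_iter a Ri Ti u idx' m.
Proof.
elim: m => //= m IHm idxE; rewrite idxE// IHm// => j jm.
by rewrite idxE// ltnS ltnW.
Qed.

Lemma random_schwarz_bound (d : measure_display) (Omega : measurableType d)
    (P : probability Omega R) (idx : nat -> {RV P >-> nat}) :
  (forall m i : nat, distribution P (idx m) [set i] = (pi i)%:E) ->
  mutually_independent idx ->
  forall m : nat,
    ('E_P[fun w => (form_norm a
            (u - schwarz_iter a Ri Ti u (fun j => idx j w) m) ^+ 2)%R]
     <= (2 * (form_norm a u ^+ 2 + Lambda ^+ 2 * A_space_norm x ^+ 2)
           / (m.+1)%:R)%:E)%E.
Proof.
move=> idx_pi idx_indep; rewrite unlock.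
set C := 2 * _.
have C0 : 0 <= C by rewrite mulr_ge0// addr_ge0 ?sqr_ge0// mulr_ge0 ?sqr_ge0.
elim=> [|m IHm].
  rewrite /= subr0 integral_cst//.
  rewrite [X in (_ * X)%E](_ : _ = 1%E) ?mule1 ?lee_fin ?invr1 ?mulr1; last first.
    exact: probability_setT.
  rewrite /C.
  have : 0 <= Lambda ^+ 2 * A_space_norm x ^+ 2 by rewrite mulr_ge0 ?sqr_ge0.
  have := sqr_ge0 (form_norm a u); lra.
pose it n := schwarz_iter a Ri Ti u (decode n) m.
pose f n := form_norm a (u - it n) ^+ 2.
pose s : R := m.+2%:R^-1.
have itE w : it (history idx m w) = schwarz_iter a Ri Ti u (fun j => idx j w) m.
  by apply: eq_schwarz_iter => j jm; exact: decode_history.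
have mX : measurable_fibers (idx m).
  by move=> i; rewrite -[X in measurable X]setTI; exact: measurable_funPT.
(* Index [m] is independent of the history, so the one-step mean estimate applies for each fixed
   past. *)
have step : (\int[P]_w (form_norm a (u - schwarz_step a Ri Ti u m (idx m w)
      (it (history idx m w))) ^+ 2)%:E <=
    \int[P]_w ((1 - s) ^+ 2 * f (history idx m w) + s ^+ 2 * C)%:E)%E.
  apply: (@integral_indep_le _ _ _ P (idx m) (history idx m) pi
    (fun n i => form_norm a (u - schwarz_step a Ri Ti u m i (it n)) ^+ 2)
    (fun n => (1 - s) ^+ 2 * f n + s ^+ 2 * C)) => //.
  - exact: measurable_history.
  - move=> n i; rewrite history_indep//; congr (_ * _)%E; exact: idx_pi.
  - by move=> n i; exact: sqr_ge0.
  - by move=> n; rewrite addr_ge0// mulr_ge0// sqr_ge0.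
  - by move=> n; exact: mean_schwarz_step_le.
rewrite (eq_integral (fun w => (form_norm a (u - schwarz_step a Ri Ti u m
  (idx m w) (it (history idx m w))) ^+ 2)%:E)); last by move=> w _; rewrite itE.
apply: (le_trans step).
have f0 n : 0 <= f n by exact: sqr_ge0.
have mf : measurable_fun setT (fun w => (f (history idx m w))%:E).
  apply: (@measurable_fun_fibers2 _ _ _ (idx m) (history idx m) setT
    (fun n _ => (f n)%:E)) => //; exact: measurable_history.
rewrite (eq_integral (fun w => ((1 - s) ^+ 2)%:E * (f (history idx m w))%:E
   + (s ^+ 2 * C)%:E)%E) => [|w _]; last by rewrite EFinD EFinM.
rewrite ge0_integralD//; last 3 first.
- by move=> w _; rewrite -EFinM lee_fin mulr_ge0// sqr_ge0.
- exact: measurable_funeM.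
- by move=> w _; rewrite lee_fin mulr_ge0// sqr_ge0.
rewrite ge0_integralZl//; last 2 first.
- by move=> w _; rewrite lee_fin.
- by rewrite lee_fin sqr_ge0.
rewrite integral_cst// [X in (_ + _ * X)%E](_ : _ = 1%E) ?mule1; last first.
  exact: probability_setT.
(* Integrating the affine bound puts the induction hypothesis in place of the mean of [f], which
   gives the recursion of [le_harmonic_succ]. *)
apply: (@le_trans _ _ (((1 - s) ^+ 2)%:E * (C / m.+1%:R)%:E + (s ^+ 2 * C)%:E)%E).
  rewrite leeD2r// lee_wpmul2l ?lee_fin ?sqr_ge0//.
  apply: le_trans IHm; rewrite le_eqVlt; apply/orP; left; apply/eqP.
  by apply: eq_integral => w _; rewrite /f itE.
rewrite -EFinM -EFinD lee_fin; exact: (le_harmonic_succ (lexx _)).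
Qed.

End random_schwarz.

Theorem theorem1 (R : realType) (k : scalar_kind)
  (V : hilbert R k)
  (V_separable : exists2 D : set V, countable D & dense D)
  (a : {hermitian_sym V for @scalar_conj R k})
  (a_continuous :
     continuous (fun p : V * V => a p.1 p.2 : (scalar R k)^o))
  (a_coercive : exists2 c : scalar R k, 0 < c &
     forall v : V, c * `|v| ^+ 2 <= a v v)
  (F : {linear V -> scalar R k | @scalar_conj R k \; *%R})
  (F_bounded : exists M : scalar R k, forall v : V, `|F v| <= M * `|v|)
  (Vi : nat -> hilbert R k)
  (Ri : forall i, {linear Vi i -> V})
  (span_dense : forall (v : V) (e : R), 0 < e ->
     exists2 x : V, splitting_span Ri [set: nat] x & form_norm a (v - x) < e)
  (Lambda : R)
  (Ri_bounded : forall (i : nat) (w : Vi i),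
     form_norm a (Ri i w) <= Lambda * form_norm (hdot (Vi i)) w)
  (Ti : forall i, V -> Vi i)
  (Ti_def : forall (i : nat) (v : V) (w : Vi i),
     hdot (Vi i) (Ti i v) w = a v (Ri i w))
  (u : V)
  (u_solution : forall v : V, a u v = F v) :
  (* a) greedy ordering *)
  (forall (beta : R) (idx : nat -> nat),
     0 < beta <= 1 ->
     (forall m : nat,
        let r := residual Ti u (schwarz_iter a Ri Ti u idx m) in
        ((beta ^+ 2)%:E *
           ereal_sup (range (fun i : nat =>
             (scalar_re (hdot (Vi i) (r i) (r i)))%:E))
         <= (scalar_re (hdot (Vi (idx m)) (r (idx m)) (r (idx m))))%:E)%E) ->
     forall x : A_space Ri (fun=> 1) 1%:E, A_space_image a x u ->
     forall m : nat,
       form_norm a (u - schwarz_iter a Ri Ti u idx m) ^+ 2 <=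
       2 * (form_norm a u ^+ 2 + (Lambda / beta) ^+ 2 * A_space_norm x ^+ 2)
         / (m.+1)%:R)
  /\
  (* b) random ordering *)
  (forall (d : measure_display) (Omega : measurableType d)
     (P : probability Omega R) (pi : nat -> R) (idx : nat -> {RV P >-> nat}),
     prob_distribution pi ->
     (forall m i : nat, distribution P (idx m) [set i] = (pi i)%:E) ->
     mutually_independent idx ->
     forall x : A_space Ri pi +oo%E, A_space_image a x u ->
     forall m : nat,
       ('E_P[fun w => (form_norm a
               (u - schwarz_iter a Ri Ti u (fun j => idx j w) m) ^+ 2)%R]
        <= (2 * (form_norm a u ^+ 2 + Lambda ^+ 2 * A_space_norm x ^+ 2)
              / (m.+1)%:R)%:E)%E).
Proof.
have a_ge0 v : 0 <= a v v.
  have [c c_gt0 /(_ v)] := a_coercive.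
  by apply: le_trans; rewrite mulr_ge0 ?exprn_ge0// ltW.
split=> [beta idx|d Omega P pi idx pi_prob idx_pi idx_indep x xu m].
  exact: (greedy_schwarz_bound a_ge0 Ri_bounded Ti_def).
exact: (random_schwarz_bound a_ge0 Ri_bounded Ti_def pi_prob xu).
Qed.
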